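(* If $\alpha$ is a monotone unbalanced connective and the support of $\mu$ does not contain the negations of projections, then the limiting distribution of the growth process $(\mu,\alpha)$ on $n$ variables is concentrated on a threshold function, i.e. on $T_m(x_1,\dots,x_n)$ for some $m\in\{0,1,\dots,n+1\}$.
   Context: A connective is a $k$-adic Boolean function $\alpha:\{0,1\}^k\to\{0,1\}$; it is balanced if it takes the value 1 on exactly half of its inputs, and unbalanced otherwise. The initial distribution $\mu$ is uniform on its support, which contains the $n$ projections $x_1,\dots,x_n$ and, here, no negations, and contains neither, one, or both of the constant functions $0,1$. The growth process $(\mu,\alpha)$ gives distributions $\pi_i$ on $n$-adic Boolean functions: $\pi_0=\mu$, and for $i\ge1$, $\pi_i(f)$ is the probability that $\alpha(g_1,\dots,g_k)=f$ where $g_1,\dots,g_k$ are independent random functions distributed according to $\pi_{i-1}$. The limiting distribution is $\pi=\lim_{i\to\infty}\pi_i$ (pointwise); it is concentrated on $f$ if $\pi(f)=1$. The threshold function $T_m(x_1,\dots,x_n)$ is 1 if and only if at least $m$ of its $n$ arguments are 1; the constants $T_{n+1}=0$ and $T_0=1$ are included as special cases. *)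

(* Defs.v *)
From mathcomp Require Import all_boot all_order all_algebra.
From mathcomp Require Import all_classical all_reals all_analysis.
Set Implicit Arguments.
Unset Strict Implicit.
Unset Printing Implicit Defensive.
Import Order.TTheory GRing.Theory Num.Theory.
Import numFieldNormedType.Exports.
Local Open Scope classical_set_scope.
Local Open Scope ring_scope.

Definition boolfun (n : nat) := {ffun {ffun 'I_n -> bool} -> bool}.

Definition projection (n : nat) (i : 'I_n) : boolfun n :=
  [ffun x : {ffun 'I_n -> bool} => x i].

Definition neg_projection (n : nat) (i : 'I_n) : boolfun n :=
  [ffun x : {ffun 'I_n -> bool} => ~~ x i].

Definition constant_fun (n : nat) (b : bool) : boolfun n :=
  [ffun => b].

Definition threshold (n m : nat) : boolfun n :=
  [ffun x : {ffun 'I_n -> bool} => (m <= #|[set i | x i]%SET|)%N].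

Lemma threshold0 (n : nat) : threshold n 0 = constant_fun n true.
Proof. by apply/ffunP => x; rewrite !ffunE. Qed.

Lemma thresholdS (n : nat) : threshold n n.+1 = constant_fun n false.
Proof.
apply/ffunP => x; rewrite !ffunE; apply/negbTE; rewrite -ltnNge ltnS.
by rewrite (leq_trans (max_card _)) // card_ord.
Qed.

Definition monotone_connective (k : nat) (alpha : boolfun k) : Prop :=
  forall x y : {ffun 'I_k -> bool},
    (forall i, x i ==> y i) -> alpha x ==> alpha y.

Definition balanced_connective (k : nat) (alpha : boolfun k) : Prop :=
  (2 * #|[set x | alpha x]%SET| = #|{ffun 'I_k -> bool}|)%N.

(* The function x |-> alpha (g_1 x, ..., g_k x). *)
Definition compose (n k : nat) (alpha : boolfun k)
    (g : {ffun 'I_k -> boolfun n}) : boolfun n :=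
  [ffun x : {ffun 'I_n -> bool} => alpha [ffun j => g j x]].

Section Growth.
Variables (R : realType) (n : nat).
Implicit Types mu pi : boolfun n -> R.

Definition is_distribution mu : Prop :=
  (forall f, 0 <= mu f) /\ \sum_(f : boolfun n) mu f = 1.

Definition dist_support mu : {set boolfun n} := [set f | mu f != 0]%SET.

Definition uniform_on_support mu : Prop :=
  forall f, f \in dist_support mu -> mu f = (#|dist_support mu|%:R)^-1.

Record initial_distribution mu : Prop := InitialDistribution {
  initial_is_distribution : is_distribution mu ;
  initial_uniform : uniform_on_support mu ;
  initial_projections : forall i, projection i \in dist_support mu ;
  initial_support : forall f, f \in dist_support mu ->
    [\/ exists i, f = projection i,
        exists i, f = neg_projection i
      | exists b, f = constant_fun n b]
}.

(* By independence, a k-tuple g of functions drawn from pi_i has probability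
   the product of the pi_i (g j). *)
Fixpoint growth (k : nat) mu (alpha : boolfun k) (i : nat) : boolfun n -> R :=
  if i is i'.+1 then
    fun f => \sum_(g : {ffun 'I_k -> boolfun n} | compose alpha g == f)
               \prod_(j < k) growth mu alpha i' (g j)
  else mu.

Definition limiting_distribution (k : nat) mu (alpha : boolfun k) pi : Prop :=
  forall f, growth mu alpha i f @[i --> \oo] --> pi f.

Definition concentrated_on pi (f : boolfun n) : Prop := pi f = 1.

End Growth.

(* Main.v *)
Require Import Defs.
From mathcomp Require Import all_boot all_order all_algebra.
From mathcomp Require Import all_classical all_reals all_analysis.
From mathcomp Require Import ring lra zify.
Set Implicit Arguments.
Unset Strict Implicit.
Unset Printing Implicit Defensive.
Import Order.TTheory GRing.Theory Num.Theory.
Import numFieldNormedType.Exports.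
Local Open Scope classical_set_scope.
Local Open Scope ring_scope.

(* Let [A p] be the probability that [alpha] is 1 on independent Bernoulli([p])
   arguments. If [f] is drawn from the [i]-th distribution, the probability that
   [f x = 1] is the [i]-th iterate of [A] at its initial value, a rational number
   which depends only on the weight of [x] and increases with it. For monotone
   [alpha] the odds ratio of [A p] to [p] is nondecreasing in [p]
   (Moore-Shannon), so the iterates converge geometrically to 0 or 1 unless they
   start at a fixed point in the open unit interval. A divisibility argument
   shows that the only rational fixed point there is [1 / 2], unless [alpha] is a
   projection; either way [alpha] would be balanced. Hence the limit assigns to
   each [x] a bit that is a monotone function of the weight of [x]. *)

(** * The amplification function of a connective *)

Definition fcons (T : Type) (k : nat) (t : T) (y : {ffun 'I_k -> T}) :
    {ffun 'I_k.+1 -> T} :=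
  [ffun i => if unlift ord0 i is Some j then y j else t].

Lemma fcons0 (T : Type) (k : nat) (t : T) (y : {ffun 'I_k -> T}) :
  fcons t y ord0 = t.
Proof. by rewrite ffunE unlift_none. Qed.

Lemma fconsS (T : Type) (k : nat) (t : T) (y : {ffun 'I_k -> T}) (j : 'I_k) :
  fcons t y (lift ord0 j) = y j.
Proof. by rewrite ffunE liftK. Qed.

Lemma big_fcons (V : nmodType) (T : finType) (k : nat)
    (P : pred {ffun 'I_k.+1 -> T}) (F : {ffun 'I_k.+1 -> T} -> V) :
  \sum_(x | P x) F x = \sum_t \sum_(y | P (fcons t y)) F (fcons t y).
Proof.
rewrite pair_big_dep /= (reindex (fun z : T * {ffun 'I_k -> T} => fcons z.1 z.2)).
  exact: eq_bigl.
exists (fun x : {ffun 'I_k.+1 -> T} => (x ord0, [ffun j => x (lift ord0 j)]))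
  => [[t y] _|x _] /=.
  by rewrite fcons0; congr pair; apply/ffunP => j; rewrite ffunE fconsS.
by apply/ffunP => i; rewrite ffunE; case: unliftP => [j|] ->; rewrite ?ffunE.
Qed.

(** The factors [a] and [c] need not sum to 1, so that denominators can later be cleared with
    [weight_scale]. *)
Definition weight (S : pzSemiRingType) (k : nat) (a c : S)
    (y : {ffun 'I_k -> bool}) : S :=
  \prod_(j < k) if y j then a else c.

Definition amplification (R : realFieldType) (k : nat) (alpha : boolfun k) (p : R) : R :=
  \sum_(y | alpha y) weight p (1 - p) y.

Lemma weight_fcons (S : pzSemiRingType) (k : nat) (a c : S) t (y : {ffun 'I_k -> bool}) :
  weight a c (fcons t y) = (if t then a else c) * weight a c y.
Proof.
rewrite /weight big_ord_recl fcons0; congr (_ * _).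
by apply: eq_bigr => j _; rewrite fconsS.
Qed.

Lemma sum_weight (S : comPzSemiRingType) (k : nat) (a c : S) :
  \sum_(y : {ffun 'I_k -> bool}) weight a c y = (a + c) ^+ k.
Proof.
rewrite -(bigA_distr_bigA (fun (_ : 'I_k) (b : bool) => if b then a else c)) /=.
by rewrite big_bool prodr_const card_ord.
Qed.

(** The two cofactors of the Shannon expansion of [alpha]; conditioning on the first argument drives
    the inductions on arity below. *)
Definition fix_first (k : nat) (alpha : boolfun k.+1) (b : bool) : boolfun k :=
  [ffun y => alpha (fcons b y)].

Lemma amplification_rec (R : realFieldType) k (alpha : boolfun k.+1) (p : R) :
  amplification alpha p = p * amplification (fix_first alpha true) p
    + (1 - p) * amplification (fix_first alpha false) p.
Proof.
rewrite /amplification big_fcons big_bool !mulr_sumr.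
by congr (_ + _); apply: eq_big => y; rewrite ?ffunE // => _; rewrite weight_fcons.
Qed.

Lemma monotone_fix_first k (alpha : boolfun k.+1) b :
  monotone_connective alpha -> monotone_connective (fix_first alpha b).
Proof.
move=> amono x y xy; rewrite !ffunE; apply: amono => i; rewrite !ffunE.
by case: unlift => //; exact: implybb.
Qed.

Lemma fix_first_le k (alpha : boolfun k.+1) y : monotone_connective alpha ->
  fix_first alpha false y ==> fix_first alpha true y.
Proof.
move=> amono; rewrite !ffunE; apply: amono => i; rewrite !ffunE.
by case: unlift => // j; exact: implybb.
Qed.

Lemma weight_ge0 (R : realFieldType) k (p : R) (y : {ffun 'I_k -> bool}) :
  0 <= p <= 1 -> 0 <= weight p (1 - p) y.
Proof. by move=> p01; apply: prodr_ge0 => j _; case: ifP => _; lra. Qed.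

Lemma weight_gt0 (R : realFieldType) k (p : R) (y : {ffun 'I_k -> bool}) :
  0 < p < 1 -> 0 < weight p (1 - p) y.
Proof. by move=> p01; apply: prodr_gt0 => j _; case: ifP => _; lra. Qed.

Lemma sum_weight1 (R : realFieldType) k (p : R) :
  \sum_(y : {ffun 'I_k -> bool}) weight p (1 - p) y = 1.
Proof. by rewrite sum_weight (_ : p + (1 - p) = 1) ?expr1n//; lra. Qed.

Lemma amplification_compl (R : realFieldType) k (alpha : boolfun k) (p : R) :
  1 - amplification alpha p = \sum_(y | ~~ alpha y) weight p (1 - p) y.
Proof.
rewrite -[X in X - _](sum_weight1 k p) (bigID (fun y => alpha y)) /= /amplification.
by rewrite addrAC subrr add0r.
Qed.

Lemma amplification_le (R : realFieldType) k (alpha beta : boolfun k) (p : R) :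
  0 <= p <= 1 -> (forall y, alpha y ==> beta y) ->
  amplification alpha p <= amplification beta p.
Proof.
move=> p01 ab; rewrite /amplification [leRHS](bigID (fun y => alpha y)) /=.
rewrite (eq_bigl (fun y => beta y && alpha y)); last first.
  by move=> y; move: (ab y); case: (alpha y) => /=; case: (beta y).
by rewrite lerDl sumr_ge0 // => y _; exact: weight_ge0.
Qed.

Lemma amplification01 (R : realFieldType) k (alpha : boolfun k) (p : R) :
  0 <= p <= 1 -> 0 <= amplification alpha p <= 1.
Proof.
move=> p01; rewrite sumr_ge0 => [|y _]; last exact: weight_ge0.
rewrite -subr_ge0 amplification_compl sumr_ge0 // => y _; exact: weight_ge0.
Qed.

(** Raising [p] increases both cofactors by induction, and shifts mass from the smaller cofactor to
    the larger one. *)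
Lemma amplification_mono (R : realFieldType) k (alpha : boolfun k) (p q : R) :
  monotone_connective alpha -> 0 <= p -> p <= q -> q <= 1 ->
  amplification alpha p <= amplification alpha q.
Proof.
elim: k alpha => [|k IH] alpha amono p0 pq q1.
  by apply: ler_sum => y _; rewrite /weight !big_ord0.
rewrite !amplification_rec.
have b_le := IH _ (monotone_fix_first true amono) p0 pq q1.
have c_le := IH _ (monotone_fix_first false amono) p0 pq q1.
have p01 : 0 <= p <= 1 by lra.
have cb := amplification_le p01 (fun y => fix_first_le y amono).
by nra.
Qed.

(** * The Moore-Shannon odds inequality *)

(* The relation [x' / (1 - x') >= r (x / (1 - x))] between [x] and [x'], where [r]
   is the ratio of the odds of [q] and [p], is stable under mixing. In the proof
   [r = v / u]; the worst case is [b' = b v / D b], [c' = c v / D c], and there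
   the difference is [u v (b - c) (v D c - u D b)] up to positive factors. *)
Lemma odds_mix (R : realFieldType) (p q b c b' c' : R) :
  0 < p -> p <= q -> q < 1 -> 0 <= c -> c <= b -> b <= 1 ->
  b * (1 - b') * (q * (1 - p)) <= b' * (1 - b) * (p * (1 - q)) ->
  c * (1 - c') * (q * (1 - p)) <= c' * (1 - c) * (p * (1 - q)) ->
  (p * b + (1 - p) * c) * (1 - (q * b' + (1 - q) * c')) * (q * (1 - p)) <=
  (q * b' + (1 - q) * c') * (1 - (p * b + (1 - p) * c)) * (p * (1 - q)).
Proof.
move=> p0 pq q1 c0 cb b1 hb hc.
set a := p * b + (1 - p) * c; set a' := q * b' + (1 - q) * c'.
pose u := p * (1 - q); pose v := q * (1 - p).
have u0 : 0 < u by rewrite mulr_gt0 // subr_gt0.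
have uv : u <= v by rewrite /u /v; lra.
(* [x * v / D x] is the number whose odds are [v / u] times the odds of [x]. *)
pose D x := x * v + (1 - x) * u.
have D_ge x : 0 <= x -> u <= D x by move=> x0; rewrite /D; nra.
have Db0 : 0 < D b by rewrite (lt_le_trans u0) // D_ge //; lra.
have Dc0 : 0 < D c by rewrite (lt_le_trans u0) // D_ge //; lra.
have a0 : 0 <= a by rewrite /a; nra.
have Da0 : 0 < D a by rewrite (lt_le_trans u0) // D_ge //; lra.
have hb' : b * v <= b' * D b by move: hb; rewrite -/u -/v /D; lra.
have hc' : c * v <= c' * D c by move: hc; rewrite -/u -/v /D; lra.
suff: a * v <= a' * D a by rewrite -/u -/v /D; lra.
rewrite -(ler_pM2r (mulr_gt0 Db0 Dc0)).
apply: (@le_trans _ _ ((q * (b * v) * D c + (1 - q) * (c * v) * D b) * D a)).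
  rewrite -subr_ge0.
  have -> : (q * (b * v) * D c + (1 - q) * (c * v) * D b) * D a
      - a * v * (D b * D c) = v * (u * (b - c)) * (v * D c - u * D b).
    by rewrite /D /a /u /v; ring.
  have Dcu := D_ge _ c0.
  have Dbv : D b <= v by rewrite /D; nra.
  apply: mulr_ge0; first by rewrite !mulr_ge0 //; lra.
  by rewrite subr_ge0; nra.
have -> : a' * D a * (D b * D c) =
    (q * (b' * D b) * D c + (1 - q) * (c' * D c) * D b) * D a.
  by rewrite /a'; ring.
rewrite ler_pM2r // lerD // ler_pM2r // ler_wpM2l //; lra.
Qed.

(** The Moore-Shannon inequality, cross-multiplied so that it still makes sense when an
    amplification is 0 or 1. Conditioning on the first argument reduces it to [odds_mix]. *)
Lemma odds_amplification (R : realFieldType) k (alpha : boolfun k) (p q : R) :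
  monotone_connective alpha -> 0 < p -> p <= q -> q < 1 ->
  amplification alpha p * (1 - amplification alpha q) * (q * (1 - p)) <=
  amplification alpha q * (1 - amplification alpha p) * (p * (1 - q)).
Proof.
elim: k alpha => [|k IH] alpha amono p0 pq q1.
  have E x y : amplification alpha x = amplification alpha y :> R.
    by apply: eq_bigr => z _; rewrite /weight !big_ord0.
  (* A connective of arity 0 is constant, so its amplification is 0 or 1 and both sides vanish. *)
  have y01 : amplification alpha p * (1 - amplification alpha p) = 0.
    rewrite /amplification; case aE: (alpha [ffun=> false]).
      rewrite (eq_bigl predT) => [|y]; last first.
        by rewrite -[RHS]aE; congr (alpha _); apply/ffunP => -[].
      by rewrite sum_weight1; lra.
    rewrite big_pred0 ?mul0r// => y.
    by rewrite -aE; congr (alpha _); apply/ffunP => -[].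
  by rewrite (E q p) y01 !mul0r.
rewrite !amplification_rec; have p01 : 0 <= p <= 1 by lra.
apply: odds_mix => //.
- by case/andP: (amplification01 (fix_first alpha false) p01).
- by apply: amplification_le => // y; exact: fix_first_le.
- by case/andP: (amplification01 (fix_first alpha true) p01).
- by apply: IH => //; exact: monotone_fix_first.
- by apply: IH => //; exact: monotone_fix_first.
Qed.

(** * Rational fixed points of the amplification *)

Lemma amplification_projection (R : realFieldType) (k : nat) (v : 'I_k) (p : R) :
  amplification (projection v) p = p.
Proof.
(* The condition [y v] is absorbed into the factor at [v], so that the sum becomes a product of sums
   over one bit. *)
pose F (j : 'I_k) (b : bool) : R :=
  if (j == v) && ~~ b then 0 else if b then p else 1 - p.
rewrite /amplification big_mkcond /=.
rewrite (eq_bigr (fun y : {ffun 'I_k -> bool} => \prod_j F j (y j))).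
  rewrite -(bigA_distr_bigA F) (bigD1 v) //= [X in _ * X]big1 => [|j /negPf jv].
    by rewrite /F big_bool eqxx /= addr0 mulr1.
  by rewrite /F big_bool jv /=; lra.
move=> y _; rewrite ffunE; case: ifP => yv.
  apply: eq_bigr => j _; rewrite /F; case: eqP => //= ->; by rewrite yv.
by apply/esym/eqP; rewrite prodf_seq_eq0; apply/hasP; exists v;
  rewrite ?mem_index_enum // /F eqxx yv eqxx.
Qed.

(** All weights are positive for [p] in the open interval, so an input accepted by [beta] but not by
    [alpha] would make the inequality strict. *)
Lemma eq_of_amplification_eq (R : realFieldType) k (alpha beta : boolfun k) (p : R) :
  0 < p < 1 -> (forall y, alpha y ==> beta y) ->
  amplification alpha p = amplification beta p -> alpha = beta.
Proof.
move=> p01 ab; rewrite /amplification [RHS](bigID (fun y => alpha y)) /=.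
rewrite (eq_bigl (fun y => beta y && alpha y)); last first.
  by move=> y; move: (ab y); case: (alpha y) => /=; case: (beta y).
move=> /esym/eqP; rewrite -subr_eq0 addrAC subrr add0r => /eqP s0; apply/ffunP => y.
move: (ab y); case aE: (alpha y) => /=; first by move->.
move=> _; case bE: (beta y) => //.
suff: 0 < \sum_(i | beta i && ~~ alpha i) weight p (1 - p) i by rewrite s0 ltxx.
rewrite (bigD1 y) /=; last by rewrite aE bE.
rewrite ltr_wpDr ?weight_gt0 ?sumr_ge0 // => z _; apply: weight_ge0; lra.
Qed.

Lemma weight_scale (R : realFieldType) k (s a c : R) (y : {ffun 'I_k -> bool}) :
  weight (s * a) (s * c) y = s ^+ k * weight a c y.
Proof.
rewrite /weight -[in s ^+ k](card_ord k) -prodr_const -big_split /=.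
by apply: eq_bigr => j _; case: ifP.
Qed.

(** At [1 / 2] all inputs have the same weight, so the amplification counts the accepted ones. *)
Lemma amplification_half (R : realFieldType) k (alpha : boolfun k) :
  amplification alpha (1 / 2 : R) = 1 / 2 -> balanced_connective alpha.
Proof.
have E y : weight (1 / 2 : R) (1 - 1 / 2) (y : {ffun 'I_k -> bool}) = (1 / 2) ^+ k.
  rewrite /weight -[in RHS](card_ord k) -prodr_const; apply: eq_bigr => j _.
  by case: ifP => _ //; lra.
rewrite /amplification (eq_bigr (fun _ => (1 / 2) ^+ k)); last by [].
rewrite sumr_const => h; rewrite /balanced_connective card_ffun card_bool card_ord.
apply/eqP; rewrite -(eqr_nat R) natrM natrX cardsE.
move: h; rewrite -[_ ^+ k *+ _]mulr_natr expr_div_n expr1n => h.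
have t0 : (2 : R) ^+ k != 0 by rewrite expf_neq0 // pnatr_eq0.
apply/eqP; apply: (mulfI (invr_neq0 t0)). rewrite mulVf //.
by move: h; rewrite mul1r; lra.
Qed.

(* The sum is divisible by [a ^ 2], so [a] divides [(a + c) ^ k.-1]. *)
Lemma coprime_sq_eq1 (k a c : nat) (b : bool) (P : pred {ffun 'I_k -> bool}) :
  coprime a c -> (0 < a)%N ->
  (forall y : {ffun 'I_k -> bool}, P y -> (2 <= #|[set i | y i == b]%SET|)%N) ->
  (\sum_(y : {ffun 'I_k -> bool} | P y) \prod_j if y j == b then a else c)%N =
    (a * (a + c) ^ k.-1)%N ->
  a = 1%N.
Proof.
move=> co a0 P2 sumE.
have : (a ^ 2 %| a * (a + c) ^ k.-1)%N.
  rewrite -sumE dvdn_sum // => y /P2 y2.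
  rewrite (bigID (fun j => y j == b)) /=; apply: dvdn_mulr.
  rewrite (eq_bigr (fun _ => a)) => [|j ->//].
  by rewrite prod_nat_const dvdn_exp2l // -cardsE.
rewrite expnS expn1 dvdn_pmul2l // => d.
have co' : coprime a ((a + c) ^ k.-1) by rewrite coprimeXr // /coprime gcdnDl.
by apply/eqP; rewrite -dvdn1 -(eqP co') dvdn_gcd dvdnn.
Qed.

Lemma projection_balanced (k : nat) (v : 'I_k) :
  balanced_connective (projection v).
Proof.
by apply: (@amplification_half rat); rewrite amplification_projection.
Qed.

Lemma card_le1 (k : nat) (P : pred 'I_k) : (0 < k)%N ->
  (#|[set i | P i]%SET| < 2)%N -> exists v, forall i, P i -> i = v.
Proof.
move=> k0; rewrite ltnS => /card_le1_eqP le1.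
case: (pickP P) => [v Pv|P0]; last by exists (Ordinal k0) => i; rewrite P0.
by exists v => i Pi; apply: le1; rewrite inE.
Qed.

(** The fixed-point equation multiplied by [(a + c) ^ k]. With [b] true it concerns the ones of
    accepted inputs, with [b] false the zeros of rejected ones; [a] is the numerator attached to the
    bit [b]. *)
Lemma sum_weight_nat (R : realFieldType) k (a c : nat) (b : bool)
    (P : pred {ffun 'I_k -> bool}) (p : R) : (0 < k)%N -> (0 < a + c)%N ->
  p = (if b then a else c)%:R / (a + c)%:R ->
  \sum_(y | P y) weight p (1 - p) y = (if b then p else 1 - p) ->
  (\sum_(y : {ffun 'I_k -> bool} | P y) \prod_j if y j == b then a else c)%N
    = (a * (a + c) ^ k.-1)%N.
Proof.
move=> k0 s0 pE sumE; apply/eqP; rewrite -(eqr_nat R) natr_sum natrM natrX.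
have sn0 : (a + c)%:R != 0 :> R by rewrite pnatr_eq0 -lt0n.
have aE : a%:R = (a + c)%:R * (if b then p else 1 - p).
  rewrite pE; case: b {pE sumE} => /=; first by rewrite mulrC divfK.
  by rewrite mulrBr mulr1 [X in _ - X]mulrC divfK // natrD addrK.
have cE : c%:R = (a + c)%:R * (if b then 1 - p else p).
  rewrite pE; case: b {pE sumE aE} => /=; last by rewrite mulrC divfK.
  by rewrite mulrBr mulr1 [X in _ - X]mulrC divfK // natrD addrAC subrr add0r.
rewrite aE -mulrA mulrCA -exprS prednK // mulrC -sumE mulr_sumr; apply/eqP.
apply: eq_bigr => y _; rewrite -weight_scale natr_prod; apply: eq_bigr => j _.
by case: (b) aE cE => <- <-; case: (y j).
Qed.

(* Coprimality pins a nontrivial rational fixed point to [1 / 2]: if no variable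
   forces [alpha], both [a ^ 2] and [c ^ 2] divide the relevant weights. *)
Lemma coprime_fixpoint (R : realFieldType) k (alpha : boolfun k) (a c : nat) :
  monotone_connective alpha -> (0 < k)%N -> coprime a c -> (0 < a)%N -> (0 < c)%N ->
  amplification alpha (a%:R / (a + c)%:R : R) = a%:R / (a + c)%:R ->
  balanced_connective alpha.
Proof.
move=> amono k0 co a0 c0; set p := (X in amplification _ X = _) => fixp.
have s0 : (0 < a + c)%N by rewrite addn_gt0 a0.
have sr0 : 0 < (a + c)%:R :> R by rewrite ltr0n.
have p01 : 0 < p < 1.
  by rewrite /p divr_gt0 ?ltr0n //= ltr_pdivrMr // mul1r ltr_nat; lia.
(* A variable below [alpha] has the same amplification at [p], hence equals [alpha]; the next case
   is the dual one. *)
case: (pselect (exists v, forall y : {ffun 'I_k -> bool}, y v ==> alpha y))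
  => [[v va]|nproj1].
  have <- : projection v = alpha; last exact: projection_balanced.
  apply: (eq_of_amplification_eq p01) => [y|]; first by rewrite ffunE.
  by rewrite amplification_projection fixp.
case: (pselect (exists v, forall y : {ffun 'I_k -> bool}, alpha y ==> y v))
  => [[v va]|nproj2].
  have -> : alpha = projection v; last exact: projection_balanced.
  apply: (eq_of_amplification_eq p01) => [y|]; first by rewrite ffunE.
  by rewrite amplification_projection fixp.
have a1 : a = 1%N.
  apply: (@coprime_sq_eq1 k a c true (fun y => alpha y)) => // [y ay|].
    (* If an accepted input had no ones outside [v], monotonicity would put [projection v] below
       [alpha]. *)
    rewrite leqNgt; apply/negP => /(card_le1 k0)[v vP]; apply: nproj1; exists v => z.
    apply/implyP => zv; move: ay; apply/implyP/amono => i.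
    by apply/implyP => yi; rewrite (vP i) // yi.
  exact: (@sum_weight_nat R _ _ _ _ _ p).
have c1 : c = 1%N.
  apply: (@coprime_sq_eq1 k c a false (fun y => ~~ alpha y)) => // [|y ay|].
  - by rewrite coprime_sym.
  (* If a rejected input had no zeros outside [v], monotonicity would put [alpha] below
     [projection v]. *)
  - rewrite leqNgt; apply/negP => /(card_le1 k0)[v vP]; apply: nproj2; exists v => z.
    apply/implyP; apply: contraLR => zv; apply: contra ay; apply/implyP/amono => i.
    apply/implyP => zi; apply: contraNT zv => yi.
    by rewrite -(vP i) // (negbTE yi).
  - apply: (@sum_weight_nat R _ _ _ _ _ p) => //; rewrite 1?addnC //.
    by rewrite -amplification_compl fixp.
by apply: (@amplification_half R); move: fixp; rewrite /p a1 c1.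
Qed.

Lemma rational_fixpoint (R : realFieldType) k (alpha : boolfun k) (a c : nat) :
  monotone_connective alpha -> (0 < k)%N -> (0 < a)%N -> (0 < c)%N ->
  amplification alpha (a%:R / (a + c)%:R : R) = a%:R / (a + c)%:R ->
  balanced_connective alpha.
Proof.
move=> amono k0 a0 c0.
have g0 : (0 < gcdn a c)%N by rewrite gcdn_gt0 a0.
have [a' aE] := dvdnP (dvdn_gcdl a c); have [c' cE] := dvdnP (dvdn_gcdr a c).
have co : coprime a' c'.
  by rewrite /coprime -(eqn_pmul2r g0) mul1n muln_gcdl -aE -cE.
have -> : a%:R / (a + c)%:R = a'%:R / (a' + c')%:R :> R.
  rewrite [in LHS]aE [in X in (_ + X)%N]cE -mulnDl !natrM -mulf_div divff ?mulr1 //.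
  by rewrite pnatr_eq0 -lt0n.
apply: coprime_fixpoint => //.
  by move: a0; rewrite aE muln_gt0 => /andP[].
by move: c0; rewrite cE muln_gt0 => /andP[].
Qed.

(** * Convergence of the iterates *)

Lemma amplification_in01 (R : realFieldType) k (alpha : boolfun k)
    (y z : {ffun 'I_k -> bool}) (p : R) :
  ~~ alpha y -> alpha z -> 0 < p < 1 -> 0 < amplification alpha p < 1.
Proof.
move=> ay az p01; apply/andP; split.
  rewrite /amplification (bigD1 z) //= ltr_wpDr ?weight_gt0 // sumr_ge0 // => w _.
  by apply: weight_ge0; lra.
rewrite -subr_gt0 amplification_compl (bigD1 y) //= ltr_wpDr ?weight_gt0 //.
by rewrite sumr_ge0 // => w _; apply: weight_ge0; lra.
Qed.

Lemma cvg_geometric_mul (R : realType) (t c : R) : 0 <= t < 1 ->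
  t ^+ i * c @[i --> \oo] --> 0.
Proof.
move=> t01; rewrite -(mul0r c); apply: cvgMl; apply: cvg_expr.
by rewrite ger0_norm; lra.
Qed.

(* The odds against 1 shrink at least by the factor they shrink in the first step. *)
Lemma iter_amplification_cvg1 (R : realType) k (alpha : boolfun k) y z (p : R) :
  monotone_connective alpha -> ~~ alpha y -> alpha z -> 0 < p < 1 ->
  p < amplification alpha p ->
  iter i (amplification alpha) p @[i --> \oo] --> (1 : R).
Proof.
move=> amono ay az p01 pA.
have A01 := amplification_in01 ay az p01.
set A := amplification alpha in pA A01 *.
have d0 : 0 < A p * (1 - p) by rewrite mulr_gt0; lra.
(* The odds against 1 at [A p], divided by those at [p]; this is below 1 because [p < A p]. *)
pose t : R := (1 - A p) * p / (A p * (1 - p)).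
have t01 : 0 <= t < 1.
  rewrite /t ltr_pdivrMr // divr_ge0 ?mulr_ge0 //=; try lra.
have u_in i : p <= iter i A p < 1.
  elim: i => [|i /andP[pu u1]] /=; first by lra.
  have /andP[_ ->] : 0 < A (iter i A p) < 1.
    by apply: (amplification_in01 ay az); rewrite u1 andbT; lra.
  rewrite andbT (le_trans (ltW pA)) //; apply: amplification_mono => //; lra.
(* The bound on the odds against 1 at the [i]-th iterate, multiplied by that iterate. *)
have odds i : 1 - iter i A p <= t ^+ i * ((1 - p) / p) * iter i A p.
  elim: i => [|i IH] /=; first by rewrite mul1r divfK //; lra.
  have /andP[pu u1] := u_in i; have /andP[pv v1] := u_in i.+1.
  move: IH u1 pu pv v1; rewrite /=; set u := iter i A p; set s := t ^+ i * _.
  move=> IH u1 pu pv v1.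
  have p0 : 0 < p by lra.
  have := odds_amplification amono p0 pu u1; rewrite -/A => key.
  (* The odds inequality between [p] and [u]: a step from [u] contracts the odds against 1 by at
     least the factor [t]. *)
  have {}key : (1 - A u) * u <= t * A u * (1 - u).
    rewrite -(ler_pM2r d0) /t.
    have -> : (1 - A p) * p / (A p * (1 - p)) * A u * (1 - u) * (A p * (1 - p)) =
      (1 - A p) * p * A u * (1 - u) by field; lra.
    by lra.
  have u0 : 0 < u by lra.
  rewrite -(ler_pM2r u0) (le_trans key) // [leRHS](_ : _ = t * A u * (s * u)).
    rewrite ler_wpM2l // mulr_ge0 //; first by case/andP: t01.
    exact: le_trans (ltW p0) pv.
  by rewrite exprS /s; ring.
apply: (@squeeze_cvgr _ _ _ _ (fun i => 1 - t ^+ i * ((1 - p) / p)) (fun=> 1)).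
- apply: nearW => i; have /andP[pu u1] := u_in i; have o := odds i.
  have s0 : 0 <= t ^+ i * ((1 - p) / p).
    case/andP: t01 => t0 _; apply: mulr_ge0; first exact: exprn_ge0.
    by apply: divr_ge0; lra.
  by apply/andP; split; nra.
- by rewrite -[X in _ --> X]subr0; apply: cvgB; [exact: cvg_cst|exact: cvg_geometric_mul].
- exact: cvg_cst.
Qed.

(** Mirror image of the previous lemma: the odds of 1 now shrink geometrically, and the iterate is
    the smaller point in the odds inequality. *)
Lemma iter_amplification_cvg0 (R : realType) k (alpha : boolfun k) y z (p : R) :
  monotone_connective alpha -> ~~ alpha y -> alpha z -> 0 < p < 1 ->
  amplification alpha p < p ->
  iter i (amplification alpha) p @[i --> \oo] --> (0 : R).
Proof.
move=> amono ay az p01 pA.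
have A01 := amplification_in01 ay az p01.
set A := amplification alpha in pA A01 *.
have d0 : 0 < (1 - A p) * p by rewrite mulr_gt0; lra.
pose t : R := A p * (1 - p) / ((1 - A p) * p).
have t01 : 0 <= t < 1.
  rewrite /t ltr_pdivrMr // divr_ge0 ?mulr_ge0 //=; try lra.
have u_in i : 0 < iter i A p <= p.
  elim: i => [|i /andP[u0 up]] /=; first by lra.
  have /andP[-> _] : 0 < A (iter i A p) < 1.
    by apply: (amplification_in01 ay az); rewrite u0 /=; lra.
  rewrite /= (le_trans _ (ltW pA)) //; apply: amplification_mono => //; lra.
have odds i : iter i A p <= t ^+ i * (p / (1 - p)) * (1 - iter i A p).
  elim: i => [|i IH] /=; first by rewrite mul1r divfK //; lra.
  have /andP[u0 up] := u_in i; have /andP[v0 vp] := u_in i.+1.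
  move: IH u0 up v0 vp; rewrite /=; set u := iter i A p; set s := t ^+ i * _.
  move=> IH u0 up v0 vp.
  have p1 : p < 1 by lra.
  have := odds_amplification amono u0 up p1; rewrite -/A => key.
  have {}key : A u * (1 - u) <= t * (1 - A u) * u.
    rewrite -(ler_pM2r d0) /t.
    have -> : A p * (1 - p) / ((1 - A p) * p) * (1 - A u) * u * ((1 - A p) * p) =
      A p * (1 - p) * (1 - A u) * u by field; lra.
    by lra.
  have u1 : 0 < 1 - u by lra.
  rewrite -(ler_pM2r u1) (le_trans key) //.
  rewrite [leRHS](_ : _ = t * (1 - A u) * (s * (1 - u))).
    rewrite ler_wpM2l // mulr_ge0 //; first by case/andP: t01.
    by rewrite subr_ge0 (le_trans vp (ltW p1)).
  by rewrite exprS /s; ring.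
apply: (@squeeze_cvgr _ _ _ _ (fun=> 0) (fun i => t ^+ i * (p / (1 - p)))).
- apply: nearW => i; have /andP[u0 up] := u_in i; have o := odds i.
  have s0 : 0 <= t ^+ i * (p / (1 - p)).
    case/andP: t01 => t0 _; apply: mulr_ge0; first exact: exprn_ge0.
    by apply: divr_ge0; lra.
  by apply/andP; split; nra.
- exact: cvg_cst.
- exact: cvg_geometric_mul.
Qed.

(** The start is written as a fraction of naturals so that [rational_fixpoint] can exclude an
    interior fixed point. Constant connectives and the endpoints 0 and 1 are treated first. *)
Lemma iter_amplification_cvg (R : realType) k (alpha : boolfun k) (a c : nat) :
  monotone_connective alpha -> ~ balanced_connective alpha -> (0 < a + c)%N ->
  exists b : bool,
    iter i (amplification alpha) (a%:R / (a + c)%:R) @[i --> \oo] --> (b%:R : R).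
Proof.
move=> amono aunbal s0; set p : R := _ / _.
have sr0 : 0 < (a + c)%:R :> R by rewrite ltr0n.
pose lo : {ffun 'I_k -> bool} := [ffun=> false].
pose hi : {ffun 'I_k -> bool} := [ffun=> true].
have le_lo y : alpha lo ==> alpha y by apply: amono => i; rewrite ffunE.
have le_hi y : alpha y ==> alpha hi by apply: amono => i; rewrite [hi i]ffunE implybT.
(* By monotonicity [alpha] is then constantly 1, and the iterates equal 1 from index 1 on; index 0
   may differ. *)
case alo: (alpha lo) => //.
  exists true; apply: cvg_near_cst; near=> i.
  have /prednK <- : (0 < i)%N by near: i; exact: nbhs_infty_gt.
  rewrite iterS /amplification (eq_bigl predT) ?sum_weight1 // => y.
  by move: (le_lo y); rewrite alo.
case ahi: (alpha hi) => //; last first.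
  exists false; apply: cvg_near_cst; near=> i.
  have /prednK <- : (0 < i)%N by near: i; exact: nbhs_infty_gt.
  rewrite iterS /amplification big_pred0 // => y.
  by move: (le_hi y); rewrite ahi implybF => /negbTE.
have k0 : (0 < k)%N.
  rewrite lt0n; apply/eqP => k0; move: alo; suff -> : lo = hi by rewrite ahi.
  by apply/ffunP => -[j jk]; exfalso; move: jk; rewrite k0.
(* The endpoint 0 is fixed because every accepted input contains a one; dually for the endpoint 1
   below. *)
case: (posnP a) => [a0|a0].
  exists false; apply: cvg_near_cst; apply: nearW => i.
  have -> : p = 0 by rewrite /p a0 mul0r.
  elim: i => //= i ->; rewrite /amplification big1 // => y ay.
  case: (pickP (fun j => y j)) => [j yj|y0]; last first.
    by move: ay; rewrite (_ : y = lo) ?alo //; apply/ffunP => j; rewrite y0 ffunE.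
  by rewrite /weight (bigD1 j) //= yj mul0r.
case: (posnP c) => [c0|c0].
  exists true; apply: cvg_near_cst; apply: nearW => i.
  have -> : p = 1 by rewrite /p c0 addn0 divff // pnatr_eq0 -lt0n.
  elim: i => //= i ->; apply/eqP; rewrite eq_sym -subr_eq0 amplification_compl.
  rewrite big1 // => y ay.
  case: (pickP (fun j => ~~ y j)) => [j yj|y0]; last first.
    move: ay; rewrite (_ : y = hi) ?ahi //; apply/ffunP => j; rewrite ffunE.
    by move: (y0 j) => /negbFE.
  by rewrite /weight (bigD1 j) //= (negbTE yj) subrr mul0r.
have p01 : 0 < p < 1.
  by rewrite /p divr_gt0 ?ltr0n //= ltr_pdivrMr // mul1r ltr_nat; lia.
have alo' := negbT alo.
case: (ltgtP p (amplification alpha p)) => pA.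
- by exists true; exact: (iter_amplification_cvg1 amono alo' ahi p01).
- by exists false; exact: (iter_amplification_cvg0 amono alo' ahi p01).
- by case: aunbal; apply: (@rational_fixpoint R _ _ a c).
Unshelve. all: by end_near.
Qed.

(** * Monotonicity in the weight and threshold functions *)

Lemma iter_amplification_mono (R : realFieldType) k (alpha : boolfun k) (p q : R) i :
  monotone_connective alpha -> 0 <= p -> p <= q -> q <= 1 ->
  0 <= iter i (amplification alpha) p /\
  iter i (amplification alpha) p <= iter i (amplification alpha) q /\
  iter i (amplification alpha) q <= 1.
Proof.
move=> amono p0 pq q1; elim: i => [//|i [u0 [uv v1]]] /=.
have u01 : 0 <= iter i (amplification alpha) p <= 1 by rewrite u0 (le_trans uv).
have v01 : 0 <= iter i (amplification alpha) q <= 1 by rewrite v1 (le_trans u0).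
split; first by case/andP: (amplification01 alpha u01).
split; first exact: amplification_mono.
by case/andP: (amplification01 alpha v01).
Qed.

(** Take for [m] the least weight of a point where [b] holds, or [n.+1] if there is none. *)
Lemma threshold_of_monotone n (b : {ffun 'I_n -> bool} -> bool) :
  (forall x y : {ffun 'I_n -> bool},
     (#|[set i | x i]%SET| <= #|[set i | y i]%SET|)%N -> b x -> b y) ->
  exists2 m, (m <= n.+1)%N & forall x, threshold n m x = b x.
Proof.
move=> bmono; case: (pickP b) => [x0 bx0|b0]; last first.
  by exists n.+1 => // x; rewrite thresholdS ffunE b0.
case: (arg_minnP (fun x : {ffun 'I_n -> bool} => #|[set i | x i]%SET|) bx0) => x bx xmin.
exists #|[set i | x i]%SET|.
  by rewrite ltnW // ltnS (leq_trans (max_card _)) // card_ord.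
move=> y; rewrite ffunE; apply/idP/idP => [xy|]; [exact: bmono bx|exact: xmin].
Qed.

(** * Reduction of the growth process to scalar iteration *)

Lemma growth_distribution (R : realType) n k (mu : boolfun n -> R)
    (alpha : boolfun k) i :
  is_distribution mu -> is_distribution (growth mu alpha i).
Proof.
move=> mud; elim: i => [//|i [ge0 sum1]]; split => [f|] /=.
  by apply: sumr_ge0 => g _; apply: prodr_ge0.
transitivity (\sum_(g : {ffun 'I_k -> boolfun n}) \prod_j growth mu alpha i (g j)).
  by rewrite [RHS](partition_big (fun g => compose alpha g) predT).
rewrite -(bigA_distr_bigA (fun (_ : 'I_k) f => growth mu alpha i f)) /=.
by rewrite big1.
Qed.

Definition prob_one (R : realType) n (mu : boolfun n -> R)
    (x : {ffun 'I_n -> bool}) : R :=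
  \sum_(f : boolfun n | f x) mu f.

Lemma prob_one_compl (R : realType) n (mu : boolfun n -> R) x :
  is_distribution mu -> \sum_(f : boolfun n | ~~ f x) mu f = 1 - prob_one mu x.
Proof.
move=> [_ <-]; rewrite [in RHS](bigID (fun f : boolfun n => f x)) /=.
by rewrite addrAC subrr add0r.
Qed.

(** At a fixed [x] the values of the independent functions are independent bits, each equal to 1
    with the probability at the previous stage. *)
Lemma prob_one_growth (R : realType) n k (mu : boolfun n -> R)
    (alpha : boolfun k) x i : is_distribution mu ->
  prob_one (growth mu alpha i) x = iter i (amplification alpha) (prob_one mu x).
Proof.
move=> mud; elim: i => [//|i IH]; rewrite iterS -{}IH.
set nu := growth mu alpha i.
have nud : is_distribution nu by exact: growth_distribution.
rewrite /prob_one /= -/nu.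
transitivity (\sum_(g : {ffun 'I_k -> boolfun n} | compose alpha g x) \prod_j nu (g j)).
  rewrite [RHS](partition_big (fun g => compose alpha g) (fun f => f x)) //=.
  apply: eq_bigr => f fx; apply: eq_bigl => g.
  by case: eqP => [->|]; rewrite ?fx ?andbF.
(* Tuples are grouped by their vector [y] of values at [x]. *)
rewrite (partition_big (fun g : {ffun 'I_k -> boolfun n} => [ffun j => g j x])
  (fun y => alpha y)) /=; last by move=> g; rewrite ffunE.
apply: eq_bigr => y ay; rewrite /weight.
(* Each factor of the weight is the mass of the functions with value [y j] at [x]; distributivity
   then recovers the sum over tuples. *)
rewrite (eq_bigr (fun j => \sum_(f : boolfun n | f x == y j) nu f)); last first.
  move=> j _; case: (y j); first by apply: eq_bigl => f; rewrite eqb_id.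
  rewrite -prob_one_compl //; apply: eq_bigl => f; by rewrite eqbF_neg.
rewrite bigA_distr_big_dep /=; apply: eq_bigl => g.
apply/andP/familyP => [[_ /eqP <-] j|h]; first by rewrite unfold_in ffunE.
have E : [ffun j => g j x] = y by apply/ffunP => j; rewrite ffunE; exact/eqP/h.
by rewrite E eqxx ffunE E.
Qed.

(** * The initial distribution *)

(** Uniformity makes the initial value a ratio of two cardinals, which the arithmetic of fixed
    points requires. *)
Lemma prob_one_uniform (R : realType) n (mu : boolfun n -> R) x :
  uniform_on_support mu ->
  prob_one mu x =
    #|[set f in dist_support mu | f x]%SET|%:R / #|dist_support mu|%:R.
Proof.
move=> unif; rewrite /prob_one (bigID (fun f => f \in dist_support mu)) /=.
rewrite [X in _ + X]big1 ?addr0 => [|f]; last first.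
  by rewrite inE negbK => /andP[_ /eqP].
rewrite (eq_bigr (fun=> #|dist_support mu|%:R^-1)) => [|f /andP[_]]; last exact: unif.
rewrite (eq_bigl (mem [set f in dist_support mu | f x]%SET)) => [|f]; last first.
  by rewrite !inE andbC.
by rewrite sumr_const -[LHS]mulr_natl.
Qed.

(** Without negations, only the projections on the ones of [x], and possibly the constant 1, take
    the value 1 at [x]. So the count depends on [x] through its weight alone. *)
Lemma card_support_one (R : realType) n (mu : boolfun n -> R) x :
  initial_distribution mu ->
  (forall i : 'I_n, neg_projection i \notin dist_support mu) ->
  #|[set f in dist_support mu | f x]%SET| =
    (#|[set i | x i]%SET| + (constant_fun n true \in dist_support mu))%N.
Proof.
move=> hmu noneg.
have proj_inj : injective (@projection n).
  by move=> i j /ffunP /(_ [ffun l => l == i]); rewrite !ffunE eqxx => /esym/eqP.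
rewrite -(card_imset _ proj_inj).
set P := imset _ _.
have -> : [set f in dist_support mu | f x]%SET = (P :|:
    [set f in dist_support mu | f == constant_fun n true])%SET.
  apply/setP => f; rewrite !inE; apply/andP/orP => [[fT fx]|[|]].
  - have /initial_support := hmu => /(_ f).
    rewrite inE => /(_ fT) [[i fE]|[i fE]|[b fE]].
    + left; apply/imsetP; exists i => //; rewrite inE.
      by move: fx; rewrite fE ffunE.
    + by move: (noneg i); rewrite -fE inE fT.
    + right; rewrite fT fE; move: fx; rewrite fE ffunE => ->.
      by rewrite eqxx.
  - case/imsetP => i; rewrite inE => xi ->; rewrite ffunE xi; split=> //.
    by have := initial_projections hmu i; rewrite inE.
  - by case/andP => -> /eqP ->; rewrite ffunE.
have Pconst : constant_fun n true \notin P.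
  apply/negP => /imsetP[i _] /ffunP /(_ [ffun=> false]).
  by rewrite !ffunE.
rewrite cardsU (_ : (P :&: _)%SET = finset.set0) ?cards0 ?subn0; last first.
  apply/setP => f; rewrite !inE; apply/negP => /and3P[fP _ /eqP fE].
  by move: Pconst; rewrite -fE fP.
congr addn.
case: (boolP (constant_fun n true \in _)) => cT /=.
  rewrite -[RHS](cards1 (constant_fun n true)); apply: eq_card => f.
  rewrite !inE; apply: andb_idl => /eqP ->; by move: cT; rewrite inE.
apply: eq_card0 => f; rewrite !inE; apply/negP => /andP[fT /eqP fE].
by move: cT; rewrite -fE inE fT.
Qed.

(** * Concentration of the limit *)

(** A function other than [f0] differs from it at some [x], and its mass is at most the vanishing
    probability of the wrong value there. There are finitely many functions, so [f0] receives all
    the mass in the limit. *)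
Lemma cvg_concentrated (R : realType) n (mu : nat -> boolfun n -> R) (f0 : boolfun n) :
  (forall i, is_distribution (mu i)) ->
  (forall x, prob_one (mu i) x @[i --> \oo] --> ((f0 x)%:R : R)) ->
  forall f, mu i f @[i --> \oo] --> ((f == f0)%:R : R).
Proof.
move=> mud cvg1.
have cvg0 f : f != f0 -> mu i f @[i --> \oo] --> (0 : R).
  move=> ff0; have [x fx] : exists x, f x != f0 x.
    apply/existsP; apply: contraR ff0 => /existsPn h.
    by apply/eqP/ffunP => x; apply/eqP; move: (h x); rewrite negbK.
  have mu_ge0 i g : 0 <= mu i g by case: (mud i).
  case f0x: (f0 x) in fx; move: (cvg1 x); rewrite f0x => c.
    apply: (@squeeze_cvgr _ _ _ _ (fun=> 0) (fun i => 1 - prob_one (mu i) x)).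
    - apply: nearW => i; rewrite mu_ge0 -prob_one_compl // (bigD1 f) /=.
        by rewrite lerDl sumr_ge0.
      by move: fx; case: (f x).
    - exact: cvg_cst.
    - by rewrite -[X in _ --> X](subrr 1); apply: cvgB => //; exact: cvg_cst.
  apply: (@squeeze_cvgr _ _ _ _ (fun=> 0) (fun i => prob_one (mu i) x)) => //.
  - apply: nearW => i; rewrite mu_ge0 /prob_one (bigD1 f) /=.
      by rewrite lerDl sumr_ge0.
    by move: fx; case: (f x).
  - exact: cvg_cst.
move=> f; case: eqP => [->|/eqP]; last exact: cvg0.
rewrite (_ : (fun i => mu i f0) = (fun i => 1 - \sum_(g | g != f0) mu i g)).
  rewrite -[X in _ --> X]subr0; apply: cvgB; first exact: cvg_cst.
  rewrite [X in _ --> X](_ : _ = \sum_(g | g != f0) (0 : R)); last by rewrite big1.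
  by apply: cvg_big => [|g gf0]; [exact: add_continuous|exact: cvg0].
by apply/funext => i; case: (mud i) => _ <-; rewrite (bigD1 f0) //= addrK.
Qed.

Theorem theorem5p5 (R : realType) (n k : nat)
    (alpha : boolfun k) (mu : boolfun n -> R)
    (halpha_mono : monotone_connective alpha)
    (halpha_unbal : ~ balanced_connective alpha)
    (hmu : initial_distribution mu)
    (hmu_noneg : forall i : 'I_n, neg_projection i \notin dist_support mu) :
  exists pi : boolfun n -> R,
    limiting_distribution mu alpha pi /\
    exists m : nat, (m <= n.+1)%N /\ concentrated_on pi (threshold n m).
Proof.
have mud := initial_is_distribution hmu.
have unif := initial_uniform hmu.
pose one x := #|[set f in dist_support mu | f x]%SET|.
have p0E x : prob_one mu x = (one x)%:R / #|dist_support mu|%:R.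
  exact: prob_one_uniform.
(* For [n = 0] there are no projections, so nonemptiness is drawn from the total mass 1. *)
have N0 : (0 < #|dist_support mu|)%N.
  rewrite lt0n; apply/eqP => /cards0_eq N0; case: mud => _ /eqP; rewrite big1.
    by rewrite eq_sym oner_eq0.
  by move=> f _; apply/eqP; have := finset.in_set0 f; rewrite -N0 inE => /negbFE.
have one_le x : (one x <= #|dist_support mu|)%N.
  by apply/subset_leq_card/fintype.subsetP => f; rewrite inE => /andP[].
have bP x : exists b : bool,
    iter i (amplification alpha) (prob_one mu x) @[i --> \oo] --> (b%:R : R).
  rewrite p0E -(subnKC (one_le x)); apply: iter_amplification_cvg => //.
  by rewrite subnKC.
have [b cvgb] := choice bP.
(* A heavier point starts at least as high, the iterates preserve this order, and so do their
   limits. *)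
have bmono (x y : {ffun 'I_n -> bool}) :
    (#|[set i | x i]%SET| <= #|[set i | y i]%SET|)%N -> b x -> b y.
  move=> xy bx; case by_: (b y) => //.
  have p_le : prob_one mu x <= prob_one mu y.
    rewrite !p0E ler_pM2r ?invr_gt0 ?ltr0n // ler_nat /one !card_support_one //.
    by rewrite leq_add2r.
  have p0 : 0 <= prob_one mu x by apply: sumr_ge0 => f _; case: mud.
  have p1 : prob_one mu y <= 1.
    by rewrite p0E ler_pdivrMr ?ltr0n // mul1r ler_nat.
  have : (b x)%:R <= (b y)%:R :> R.
    apply: (ler_cvg_to (cvgb x) (cvgb y)); apply: nearW => i.
    by case: (iter_amplification_mono i halpha_mono p0 p_le p1) => _ [].
  by rewrite bx by_ ler10.
have [m mn mE] := threshold_of_monotone bmono.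
exists (fun f => (f == threshold n m)%:R); split; last first.
  by exists m; split; rewrite // /concentrated_on eqxx.
move=> f; apply: (@cvg_concentrated R n (growth mu alpha) (threshold n m)).
  by move=> i; exact: growth_distribution.
move=> x; rewrite mE; under eq_cvg do rewrite prob_one_growth //.
exact: cvgb.
Qed.
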